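(* Let $\{F_n\}_{n\ge 0}$ be a sequence of natural numbers with $F_n\ge 1$ for $n\ge1$ (and $F_0=1$, or exceptionally $F_0=0$), and let $\Pi$ be the cobweb poset designated by it. Let $\mu$ be the Möbius function of $\Pi$, i.e. the inverse of the zeta function $\zeta$ in the incidence algebra $I(\Pi)$. Then for all $x=\langle s,t\rangle$ and $y=\langle u,v\rangle$ in $\Pi$, $$\mu(\langle s,t\rangle,\langle u,v\rangle)=\delta(t,v)\,\delta(s,u)-\delta(t+1,v)+\sum_{k=2}^{\infty}\delta(t+k,v)\,(-1)^{k}\prod_{i=t+1}^{v-1}(F_i-1).$$
   Context: Cobweb poset: for $s\ge 1$ the $s$-th level is $\Phi_s=\{\langle j,s\rangle : 1\le j\le F_s\}$, and $\Phi_0=\{\langle 1,0\rangle\}$ is a single root (this is also the convention when $F_0=0$). The cobweb poset is $\Pi=(V,\le)$ with $V=\bigcup_{s\ge 0}\Phi_s$ and $\langle s,t\rangle\le\langle u,v\rangle$ if and only if $t<v$, or $t=v$ and $s=u$. It is locally finite. Incidence algebra: for an associative ring $R$ with identity, $I(\Pi)$ is the set of functions $f:\Pi\times\Pi\to R$ with $f(x,y)=0$ unless $x\le y$, with pointwise addition and scalar multiplication and product $(f*g)(x,y)=\sum_{x\le z\le y}f(x,z)g(z,y)$. Its identity is $\delta(x,y)$ (equal to $1$ if $x=y$ and $0$ otherwise). The zeta function is $\zeta(x,y)=1$ if $x\le y$ and $0$ otherwise. On integers, $\delta(a,b)$ is the Kronecker delta. Integers are regarded as elements of $R$ in the usual way.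 *)

(* Defs.v *)
From HB Require Import structures.
From mathcomp Require Import all_boot all_order all_algebra.
From mathcomp Require Import boolp classical_sets functions cardinality fsbigop.

Set Implicit Arguments.
Unset Strict Implicit.
Unset Printing Implicit Defensive.

Import Order.TTheory GRing.Theory.

Local Open Scope classical_set_scope.
Local Open Scope ring_scope.

(* The pair [(j, s)] is the vertex <j, s>: position [j], counted from 1, on
   level [s]. Level 0 is a single root whatever the value of [F 0]. *)
Definition level_size (F : nat -> nat) (s : nat) : nat :=
  if s is 0%N then 1%N else F s.

Definition is_vertex (F : nat -> nat) : pred (nat * nat) :=
  fun p => (1 <= p.1 <= level_size F p.2)%N.

Record cobweb (F : nat -> nat) : Type :=
  Cobweb { vertex : nat * nat; _ : is_vertex F vertex }.

HB.instance Definition _ (F : nat -> nat) := [isSub for @vertex F].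
HB.instance Definition _ (F : nat -> nat) := [Countable of cobweb F by <:].

Section CobwebOrder.
Variable F : nat -> nat.
Implicit Types x y z : cobweb F.

Definition cobweb_le x y : bool :=
  let: (s, t) := vertex x in let: (u, v) := vertex y in
  (t < v)%N || (t == v) && (s == u).

Lemma cobweb_le_refl : reflexive cobweb_le.
Proof. by move=> x; rewrite /cobweb_le; case: vertex => s t; rewrite !eqxx orbT. Qed.

Lemma cobweb_le_anti : antisymmetric cobweb_le.
Proof.
move=> x y; rewrite /cobweb_le => lexy; apply: val_inj => /=.
move: lexy; case: (vertex x) (vertex y) => [s t] [u v].
case/andP=> /orP[lt_tv|/andP[/eqP-> /eqP->]] //.
by case/orP=> [|/andP[/eqP<- /eqP<-]] //; rewrite ltnNge ltnW.
Qed.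

Lemma cobweb_le_trans : transitive cobweb_le.
Proof.
move=> y x z; rewrite /cobweb_le.
case: (vertex x) (vertex y) (vertex z) => [s t] [u v] [a b].
case/orP=> [lt_tv|/andP[/eqP-> /eqP->]] //.
by case/orP=> [/(ltn_trans lt_tv)->|/andP[/eqP<- _]] //; rewrite lt_tv.
Qed.

End CobwebOrder.

Fact cobweb_display : Order.disp_t. Proof. exact: Order.Disp tt tt. Qed.

HB.instance Definition _ (F : nat -> nat) :=
  Order.Le_isPOrder.Build cobweb_display (cobweb F)
    (@cobweb_le_refl F) (@cobweb_le_anti F) (@cobweb_le_trans F).

Section CobwebFinite.
Variable F : nat -> nat.
Implicit Types x y z : cobweb F.

Definition vertices_upto (n : nat) : seq (cobweb F) :=
  undup (pmap insub
    [seq (j, s) | s <- iota 0 n.+1, j <- iota 0 (level_size F s).+1]).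

Lemma mem_vertices_upto n x :
  (x \in vertices_upto n) = ((vertex x).2 <= n)%N.
Proof.
rewrite mem_undup mem_pmap_sub; apply/allpairsPdep/idP.
  by case=> s [j [+ _ ->]]; rewrite mem_iota.
move=> le_n; exists (vertex x).2, (vertex x).1; split; last exact: surjective_pairing.
  by rewrite mem_iota.
by rewrite mem_iota add0n ltnS; case/andP: (valP x).
Qed.

Lemma cobweb_le_level x y : (x <= y)%O -> ((vertex x).2 <= (vertex y).2)%N.
Proof.
rewrite /Order.le /= /cobweb_le.
case: (vertex x) (vertex y) => [s t] [u v] /=.
by case/orP=> [/ltnW|/andP[/eqP->]].
Qed.

Lemma cobweb_locally_finite x y : finite_set [set z | (x <= z <= y)%O].
Proof.
apply: sub_finite_set (finite_seq (vertices_upto (vertex y).2)) => z /=.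
by case/andP=> _ /cobweb_le_level; rewrite mem_vertices_upto.
Qed.

End CobwebFinite.

Section Incidence.
Variables (R : pzRingType) (F : nat -> nat).
Implicit Types x y z : cobweb F.

Definition is_incidence : pred (cobweb F -> cobweb F -> R) :=
  fun f => `[< forall x y, ~~ (x <= y)%O -> f x y = 0 >].

Record incidence : Type := Incidence {
  incidence_fun :> cobweb F -> cobweb F -> R;
  _ : is_incidence incidence_fun
}.

HB.instance Definition _ := [isSub for incidence_fun].
HB.instance Definition _ := [Choice of incidence by <:].

Lemma incidence0 (f : incidence) x y : ~~ (x <= y)%O -> f x y = 0.
Proof. by move: x y; apply/asboolP; exact: (valP f). Qed.

Lemma incidence_eq (f g : incidence) : (forall x y, f x y = g x y) -> f = g.
Proof. by move=> fg; apply: val_inj; apply/funext => x; apply/funext => y; exact: fg. Qed.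

Fact incidence_zmod_closed : zmod_closed is_incidence.
Proof.
split=> [|f g /asboolP f0 /asboolP g0]; apply/asboolP => x y // Nxy.
have -> : (f - g) x y = f x y - g x y by [].
by rewrite f0 // g0 // subrr.
Qed.

HB.instance Definition _ :=
  GRing.SubChoice_isSubZmodule.Build _ _ incidence incidence_zmod_closed.

Definition convolution (f g : cobweb F -> cobweb F -> R) x y : R :=
  \sum_(z \in [set z | (x <= z <= y)%O]) f x z * g z y.

Definition delta_fun x y : R := (x == y)%:R.

Definition zeta_fun x y : R := (x <= y)%O%:R.

Fact convolution_incidence (f g : incidence) : is_incidence (convolution f g).
Proof.
apply/asboolP => x y Nxy; rewrite /convolution fsbig1 // => z /= /andP[xz zy].
by rewrite (le_trans xz zy) in Nxy.
Qed.

Fact delta_incidence : is_incidence delta_fun.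
Proof.
by apply/asboolP => x y Nxy; rewrite /delta_fun; case: eqP Nxy => // ->; rewrite lexx.
Qed.

Fact zeta_incidence : is_incidence zeta_fun.
Proof. by apply/asboolP => x y /negPf; rewrite /zeta_fun => ->. Qed.

Definition incidence_mul (f g : incidence) : incidence :=
  Incidence (convolution_incidence f g).

Definition delta : incidence := Incidence delta_incidence.

Definition zeta : incidence := Incidence zeta_incidence.

Lemma convolutionE (f g : incidence) n x y : ((vertex y).2 <= n)%N ->
  convolution f g x y = \sum_(z <- vertices_upto F n) f x z * g z y.
Proof.
move=> yn; rewrite fsbig_seq ?undup_uniq // /convolution.
apply: fsbig_widen => [z /= /andP[_ /cobweb_le_level zy]|z /= [_ Nz]].
  by rewrite mem_vertices_upto (leq_trans zy).
case: (boolP (x <= z)%O) => [xz|/incidence0-> ]; last by rewrite mul0r.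
case: (boolP (z <= y)%O) => [zy|/incidence0-> ]; last by rewrite mulr0.
by case: Nz; rewrite xz.
Qed.

Fact incidence_mulA : associative incidence_mul.
Proof.
move=> f g h; apply: incidence_eq => x y; pose n := (vertex y).2.
rewrite [LHS](@convolutionE f (incidence_mul g h) n) //.
rewrite [RHS](@convolutionE (incidence_mul f g) h n) //.
transitivity (\sum_(z <- vertices_upto F n) \sum_(w <- vertices_upto F n)
                 f x z * g z w * h w y).
  apply: eq_bigr => z _; rewrite [X in _ * X](@convolutionE g h n) // mulr_sumr.
  by apply: eq_bigr => w _; rewrite mulrA.
rewrite exchange_big !big_seq /=; apply: eq_bigr => w.
by rewrite mem_vertices_upto => wn; rewrite [X in X * _](convolutionE f g _ wn) mulr_suml.
Qed.

Fact incidence_mul1f : left_id delta incidence_mul.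
Proof.
move=> f; apply: incidence_eq => x y.
case: (boolP (x <= y)%O) => [xy|Nxy]; last first.
  by rewrite !incidence0.
rewrite [LHS](@convolutionE delta f (vertex y).2) //.
rewrite (bigD1_seq x) ?undup_uniq ?mem_vertices_upto ?cobweb_le_level //=.
rewrite /delta_fun eqxx mul1r big1 ?addr0 // => z /negPf.
by rewrite eq_sym => ->; rewrite mul0r.
Qed.

Fact incidence_mulf1 : right_id delta incidence_mul.
Proof.
move=> f; apply: incidence_eq => x y.
rewrite [LHS](@convolutionE f delta (vertex y).2) //.
rewrite (bigD1_seq y) ?undup_uniq ?mem_vertices_upto //=.
by rewrite /delta_fun eqxx mulr1 big1 ?addr0 // => z /negPf->; rewrite mulr0.
Qed.

Fact incidence_mulDl : left_distributive incidence_mul +%R.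
Proof.
move=> f g h; apply: incidence_eq => x y.
change (convolution (f + g) h x y = convolution f h x y + convolution g h x y).
rewrite !(@convolutionE _ _ (vertex y).2) // -big_split /=.
by apply: eq_bigr => z _; rewrite -mulrDl.
Qed.

Fact incidence_mulDr : right_distributive incidence_mul +%R.
Proof.
move=> f g h; apply: incidence_eq => x y.
change (convolution f (g + h) x y = convolution f g x y + convolution f h x y).
rewrite !(@convolutionE _ _ (vertex y).2) // -big_split /=.
by apply: eq_bigr => z _; rewrite -mulrDr.
Qed.

HB.instance Definition _ := GRing.Zmodule_isPzRing.Build incidence
  incidence_mulA incidence_mul1f incidence_mulf1 incidence_mulDl incidence_mulDr.

(* The inverse of [zeta] in the ring [incidence]. It is unique when it exists;
   the default value 0 is taken only if [zeta] has no two-sided inverse. *)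
Definition mobius : incidence :=
  xget 0 [set m : incidence | m * zeta = 1 /\ zeta * m = 1].

End Incidence.

Arguments delta R F : clear implicits.
Arguments zeta R F : clear implicits.
Arguments mobius R F : clear implicits.

(* Main.v *)
(** Splitting a convolution [f * g] at [(x, y)] along the levels between [x]
    and [y] turns [mu * zeta = delta] into a recurrence in which level [w]
    contributes [F w] equal terms. For [x] on level [t] and [y] on level [v > t]
    its solution is [(-1)^(v-t) prod_(t < i < v) (F i - 1)], since passing from
    [v] to [v+1] multiplies it by [1 - F v]. The mirrored recurrence in [t] gives
    [zeta * mu = delta]. *)

Require Import Defs.
From mathcomp Require Import all_boot all_order all_algebra.
From mathcomp Require Import boolp classical_sets functions cardinality fsbigop.

Local Open Scope classical_set_scope.
Local Open Scope ring_scope.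

Import Order.TTheory GRing.Theory.

Notation level x := (vertex x).2.

Section Levels.
Variable F : nat -> nat.
Implicit Types x y z : cobweb F.

Definition level_vertices (w : nat) : seq (cobweb F) :=
  pmap insub [seq (j, w) | j <- iota 1 (level_size F w)].

Lemma mem_level_vertices w x : (x \in level_vertices w) = (level x == w).
Proof.
rewrite mem_pmap_sub; apply/mapP/eqP => [[j _ ->] //|<-].
exists (vertex x).1; last exact: surjective_pairing.
by rewrite mem_iota add1n ltnS; exact: (valP x).
Qed.

Lemma level_vertices_uniq w : uniq (level_vertices w).
Proof. by rewrite pmap_sub_uniq // map_inj_uniq ?iota_uniq // => i j []. Qed.

Lemma size_level_vertices w : size (level_vertices w) = level_size F w.
Proof.
rewrite size_pmap_sub count_map -[RHS](size_iota 1); apply/eqP; rewrite -all_count.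
by apply/allP => j; rewrite mem_iota add1n ltnS.
Qed.

Lemma perm_vertices_upto n :
  perm_eq (vertices_upto F n.+1) (vertices_upto F n ++ level_vertices n.+1).
Proof.
apply: uniq_perm => [||z]; first exact: undup_uniq.
  rewrite cat_uniq undup_uniq level_vertices_uniq andbT /=.
  by apply/hasPn => z; rewrite mem_level_vertices mem_vertices_upto => /eqP->; rewrite ltnn.
by rewrite mem_cat !mem_vertices_upto mem_level_vertices leq_eqVlt orbC.
Qed.

Lemma sum_vertices_upto (V : nmodType) (f : cobweb F -> V) n :
  \sum_(z <- vertices_upto F n) f z =
  \sum_(0 <= w < n.+1) \sum_(z <- level_vertices w) f z.
Proof.
elim: n => [|n IHn]; last first.
  by rewrite (perm_big _ (perm_vertices_upto n)) big_cat big_nat_recr //= IHn.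
rewrite big_nat1; apply: perm_big; apply: uniq_perm => [||z].
- exact: undup_uniq.
- exact: level_vertices_uniq.
by rewrite mem_vertices_upto mem_level_vertices leqn0.
Qed.

(** Away from equality the order sees only levels, so [zeta_fun x z] stays constant as [z] runs over
    a level strictly above [x]. *)
Lemma cobweb_leE x y : (x <= y)%O = (level x < level y)%N || (x == y).
Proof.
rewrite -(inj_eq val_inj) /Order.le /= /cobweb_le.
by case: (vertex x) (vertex y) => [s t] [u v]; rewrite xpair_eqE andbC.
Qed.

Lemma cobweb_le_eq x y : level x = level y -> (x <= y)%O = (x == y).
Proof. by rewrite cobweb_leE => ->; rewrite ltnn. Qed.

End Levels.

Section Mobius.
Variables (R : pzRingType) (F : nat -> nat).
Implicit Types (x y z : cobweb F) (f g : incidence R F).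

Lemma convolution_diag f g x : convolution f g x x = f x x * g x x.
Proof.
rewrite /convolution (_ : [set z | _] = [set x]) ?fsbig_set1 //.
apply/seteqP; split=> z /= => [/le_anti //|->].
by rewrite lexx.
Qed.

(** Levels below [x] drop out because [f x z = 0] there. Distinct vertices of one level are
    incomparable, so the two end levels reduce to [x] and [y]. *)
Lemma convolution_split f g x y : (level x < level y)%N ->
  convolution f g x y = f x x * g x y
    + \sum_((level x).+1 <= w < level y)
        \sum_(z <- level_vertices F w) f x z * g z y
    + f x y * g y y.
Proof.
move=> ltxy; rewrite (@convolutionE _ _ f g (level y)) // sum_vertices_upto.
rewrite big_nat_recr //= (big_cat_nat (leq0n _) (ltnW ltxy)) /=.
rewrite big_nat big1 ?add0r => [|w /andP[_ ltwx]]; last first.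
  rewrite big_seq big1 // => z; rewrite mem_level_vertices => /eqP zw.
  rewrite incidence0 ?mul0r //; apply/negP => /cobweb_le_level.
  by rewrite zw leqNgt ltwx.
rewrite big_ltn // (bigD1_seq x) ?mem_level_vertices ?level_vertices_uniq //=.
rewrite big_seq_cond big1 ?addr0 => [|z]; last first.
  rewrite mem_level_vertices => /andP[/eqP zx neq].
  by rewrite incidence0 ?mul0r // cobweb_le_eq // eq_sym.
congr (_ + _); rewrite (bigD1_seq y) ?mem_level_vertices ?level_vertices_uniq //=.
rewrite big_seq_cond big1 ?addr0 // => z.
rewrite mem_level_vertices => /andP[/eqP zy neq].
by rewrite [g z y]incidence0 ?mulr0 // cobweb_le_eq.
Qed.

(** The bound [0 < w] matters: the root level has one vertex even when [F 0] is 0. *)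
Lemma sum_level_const w (c : R) (f : cobweb F -> R) :
    (0 < w)%N -> (forall z, level z = w -> f z = c) ->
  \sum_(z <- level_vertices F w) f z = c *+ F w.
Proof.
move=> w_gt0 fc; rewrite big_seq (eq_bigr (fun=> c)) => [|z]; last first.
  by rewrite mem_level_vertices => /eqP; exact: fc.
rewrite -big_seq big_const_seq count_predT iter_addr_0 size_level_vertices.
by case: w w_gt0 {fc}.
Qed.

(** Meant for [t < v] only: otherwise the truncated exponent and the empty product give 1, which is
    wrong for distinct vertices of one level. *)
Definition mobius_level (t v : nat) : R :=
  (-1) ^+ (v - t) * \prod_(t.+1 <= i < v) ((F i)%:R - 1).

Lemma mobius_levelS t : mobius_level t t.+1 = -1.
Proof. by rewrite /mobius_level subSnn big_geq // mulr1. Qed.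

(** The extra factor is [1 - F v], written with [*+] to match the level sums of
    [sum_level_const]. *)
Lemma mobius_level_recr t v : (t < v)%N ->
  mobius_level t v.+1 = mobius_level t v - mobius_level t v *+ F v.
Proof.
move=> tv; rewrite /mobius_level big_nat_recr //= subSn 1?ltnW // exprS.
by rewrite -mulrA mulN1r mulrA mulrBr mulr1 mulr_natr opprB.
Qed.

Lemma mobius_level_recl t v : (t.+1 < v)%N ->
  mobius_level t v = mobius_level t.+1 v - mobius_level t.+1 v *+ F t.+1.
Proof.
move=> tv; rewrite /mobius_level big_ltn // -(subSS t) subSn 1?ltnW // exprS.
rewrite -mulrA mulN1r mulrBl mul1r mulrBr opprB mulr_natl; congr (_ - _).
by rewrite mulrnAr.
Qed.

Lemma sum_mobius_level_left t v : (t < v)%N ->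
  1 + \sum_(t.+1 <= w < v) mobius_level t w *+ F w + mobius_level t v = 0.
Proof.
elim: v => // v IHv; rewrite ltnS leq_eqVlt => /orP[/eqP->|tv].
  by rewrite big_geq // mobius_levelS addr0 subrr.
(* The summand of the new level [v] cancels the multiple that the recurrence subtracts. *)
rewrite big_nat_recr //= mobius_level_recr // addrA -[RHS](IHv tv).
by rewrite -!addrA; congr (_ + (_ + _)); rewrite addrC subrK.
Qed.

Lemma sum_mobius_level_right t v : (t < v)%N ->
  mobius_level t v + \sum_(t.+1 <= w < v) mobius_level w v *+ F w + 1 = 0.
Proof.
(* Induction on the gap [d] with [t] free: raising [t] by one lowers [d] by one and keeps [v]
   fixed. *)
move=> tv; have [d ->] : exists d, v = (d + t.+1)%N.
  by exists (v - t.+1)%N; rewrite subnK.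
elim: d t {tv} => [|d IHd] t; first by rewrite add0n big_geq // mobius_levelS addr0 addNr.
have lt_t : (t.+1 < d.+1 + t.+1)%N by rewrite addSn ltnS leq_addl.
rewrite big_ltn // mobius_level_recl // addrA subrK -[RHS](IHd t.+1).
by rewrite addSnnS.
Qed.

Definition mobius_fun x y : R :=
  if x == y then 1
  else if (level x < level y)%N then mobius_level (level x) (level y) else 0.

Fact mobius_fun_incidence : is_incidence mobius_fun.
Proof.
apply/asboolP => x y; rewrite cobweb_leE negb_or /mobius_fun.
by case/andP=> /negPf-> /negPf->.
Qed.

Definition mobius_explicit : incidence R F := Incidence mobius_fun_incidence.

Lemma mobius_fun_diag x : mobius_fun x x = 1.
Proof. by rewrite /mobius_fun eqxx. Qed.

Lemma mobius_fun_lt x y : (level x < level y)%N ->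
  mobius_fun x y = mobius_level (level x) (level y).
Proof. by rewrite /mobius_fun => xy; rewrite xy; case: eqP xy => // ->; rewrite ltnn. Qed.

Lemma zeta_fun_diag x : zeta_fun R x x = 1.
Proof. by rewrite /zeta_fun lexx. Qed.

Lemma zeta_fun_lt x y : (level x < level y)%N -> zeta_fun R x y = 1.
Proof. by rewrite /zeta_fun cobweb_leE => ->. Qed.

(** Two checks suffice: a pair of distinct vertices without a strict rise in level is not
    comparable, so both sides vanish there. *)
Lemma incidence_mul_eq1 f g :
    (forall x, f x x * g x x = 1) ->
    (forall x y, (level x < level y)%N -> convolution f g x y = 0) ->
  f * g = 1.
Proof.
move=> fg1 fg0; apply: incidence_eq => x y.
change (convolution f g x y = delta_fun R x y); rewrite /delta_fun.
case: eqP => [->|/eqP neq]; first by rewrite convolution_diag fg1.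
have [/fg0 //|/negPf nlt] := boolP (level x < level y)%N.
by rewrite [LHS](incidence0 (incidence_mul f g)) // cobweb_leE nlt.
Qed.

Lemma mobius_explicit_zeta : mobius_explicit * zeta R F = 1.
Proof.
apply: incidence_mul_eq1 => [x|x y xy].
  by rewrite /= mobius_fun_diag zeta_fun_diag mulr1.
rewrite convolution_split //= mobius_fun_diag !zeta_fun_diag mul1r mulr1.
rewrite zeta_fun_lt // mobius_fun_lt // -[RHS](sum_mobius_level_left _ _ xy).
congr (_ + _ + _); apply: eq_big_nat => w /andP[xw wy].
(* Level [w] lies above [x], hence is not the root level and has [F w] vertices. *)
rewrite (@sum_level_const w (mobius_level (level x) w)) ?(leq_trans _ xw) // => z zw.
by rewrite zeta_fun_lt ?mobius_fun_lt ?zw ?mulr1.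
Qed.

Lemma zeta_mobius_explicit : zeta R F * mobius_explicit = 1.
Proof.
apply: incidence_mul_eq1 => [x|x y xy].
  by rewrite /= mobius_fun_diag zeta_fun_diag mulr1.
rewrite convolution_split //= !mobius_fun_diag !zeta_fun_diag mul1r mulr1.
rewrite zeta_fun_lt // mobius_fun_lt // -[RHS](sum_mobius_level_right _ _ xy).
congr (_ + _ + _); apply: eq_big_nat => w /andP[xw wy].
rewrite (@sum_level_const w (mobius_level w (level y))) ?(leq_trans _ xw) // => z zw.
by rewrite zeta_fun_lt ?mobius_fun_lt ?zw ?mul1r.
Qed.

Lemma mobiusE : mobius R F = mobius_explicit.
Proof.
apply: xget_unique => [|m [mz _]].
  by split; [exact: mobius_explicit_zeta | exact: zeta_mobius_explicit].
(* A left inverse [m] of zeta equals its right inverse: insert [zeta * mobius_explicit] after [m]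
   and reassociate. *)
by rewrite -[m]mulr1 -zeta_mobius_explicit mulrA mz mul1r.
Qed.

End Mobius.

Theorem mainTheorem1 (R : pzRingType) (F : nat -> nat)
    (hF0 : F 0%N = 1%N \/ F 0%N = 0%N)
    (hF : forall n : nat, (1 <= n)%N -> (1 <= F n)%N)
    (s t u v : nat) (hx : is_vertex F (s, t)) (hy : is_vertex F (u, v)) :
  mobius R F (Cobweb hx) (Cobweb hy) =
    (t == v)%:R * (s == u)%:R - (t.+1 == v)%:R
    + \sum_(k \in [set k : nat | (2 <= k)%N])
        (t + k == v)%N%:R * (-1) ^+ k * \prod_(t.+1 <= i < v) ((F i)%:R - 1 : R).
Proof.
rewrite mobiusE /= /mobius_fun /= -(inj_eq val_inj) /= xpair_eqE.
(* The series matters only from [v = t + 2] on; below that no [k >= 2] satisfies [t + k = v]. *)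
have sum0 : (v <= t.+1)%N -> \sum_(k \in [set k : nat | (2 <= k)%N])
    (t + k == v)%N%:R * (-1) ^+ k * \prod_(t.+1 <= i < v) ((F i)%:R - 1 : R) = 0.
  move=> vt; rewrite fsbig1 // => k /= k_ge2.
  by rewrite gtn_eqF ?mul0r // (leq_ltn_trans vt) // -addn1 ltn_add2l.
case: (ltngtP t v) => [tv|vt|tv]; last first.
- rewrite sum0 ?tv ?leqnSn // (gtn_eqF (ltnSn v)) subr0 addr0 mul1r andbT.
  by case: eqP.
- by rewrite sum0 ?(ltnW (leqW _)) // (gtn_eqF (leqW vt)) andbF mul0r subr0 addr0.
rewrite andbF mul0r sub0r; have [vE|neq] := eqVneq t.+1 v.
  by rewrite sum0 -vE // mobius_levelS addr0.
(* Here [v >= t + 2], and the only index with a nonzero Kronecker factor is [k = v - t]; its term is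
   [mobius_level t v]. *)
rewrite oppr0 add0r -(fsbig_widen [set (v - t)%N]) => [|k /= ->|k /= [_ nk]].
- by rewrite fsbig_set1 subnKC 1?ltnW // eqxx mul1r.
- by rewrite ltn_subRL addn1 ltn_neqAle neq.
by case: eqP nk => [<-|]; rewrite ?mul0r // addKn.
Qed.
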